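(* Let $M$ and $N$ be log-convex weight sequences. Then both $v_M$ and $v_N$ are essential and the following are equivalent: (i) there exists $A\ge1$ such that $N_j\le AM_j$ for all $j\in\mathbb{N}$; (ii) $v_M\preceq v_N$; (iii) $H^{\infty}_{v_M}(\mathbb{C})\subseteq H^{\infty}_{v_N}(\mathbb{C})$, with continuous inclusion. Thus, there exists $C\ge1$ with $\frac1C N_j\le M_j\le CN_j$ for all $j\in\mathbb{N}$ if and only if $v_M\sim v_N$, if and only if $H^{\infty}_{v_M}(\mathbb{C})=H^{\infty}_{v_N}(\mathbb{C})$ as Banach spaces (i.e. as sets, with equivalent norms).
   Context: $\mathbb{N}=\{0,1,2,\dots\}$. A weight is a continuous, non-increasing function $v:[0,+\infty)\to(0,+\infty)$ with $\lim_{t\to+\infty}t^kv(t)=0$ for all $k\ge0$. $H(\mathbb{C})$ is the space of entire functions and $H^{\infty}_v(\mathbb{C}):=\{f\in H(\mathbb{C}):\|f\|_v:=\sup_{z\in\mathbb{C}}|f(z)|v(|z|)<+\infty\}$, a Banach space with norm $\|\cdot\|_v$. For positive functions $v,w$ on $[0,+\infty)$, $v\preceq w$ means: there is $C\ge1$ with $w(t)\le Cv(t)$ for all $t\ge0$; $v\sim w$ means $v\preceq w$ and $w\preceq v$. For a weight $v$ put $B:=\{f\in H(\mathbb{C}):|f(z)|\le 1/v(|z|)\ \forall z\in\mathbb{C}\}$, $\widetilde{w_v}(z):=\sup\{|f(z)|:f\in B\}$ (a radial function) and $\widetilde v:=1/\widetilde{w_v}$. The weight $v$ is essential if $v\sim\widetilde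 v$. A weight sequence is $M=(M_j)_{j\in\mathbb{N}}$ with $M_j>0$, $M_0=1$ and $\lim_{j\to+\infty}(M_j)^{1/j}=+\infty$; it is log-convex if $M_j^2\le M_{j-1}M_{j+1}$ for all $j\ge1$. Put $\omega_M(t):=\sup_{j\in\mathbb{N}}\log(t^j/M_j)$ for $t>0$, $\omega_M(0):=0$, and $v_M(t):=\exp(-\omega_M(t))$, which is a weight. *)

(* Defs.v *)
From Stdlib Require Export Reals.
From Coquelicot Require Export Coquelicot.
Open Scope R_scope.

(* A function on [0,+oo) is represented by a function R -> R of which only the
   values at t >= 0 are ever used. *)

Definition weight (v : R -> R) : Prop :=
  continuous_on (fun t => 0 <= t) v /\
  (forall s t, 0 <= s -> s <= t -> v t <= v s) /\
  (forall t, 0 <= t -> 0 < v t) /\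
  (forall k : nat, is_lim (fun t => t ^ k * v t) p_infty 0).

Definition entire (f : C -> C) : Prop :=
  forall z : C, @ex_derive C_AbsRing C_NormedModule f z.

Definition norm_v (v : R -> R) (f : C -> C) : Rbar :=
  Lub_Rbar (fun y : R => exists z : C, y = Cmod (f z) * v (Cmod z)).

Definition Hinf (v : R -> R) (f : C -> C) : Prop :=
  entire f /\ Rbar_lt (norm_v v f) p_infty.

(* The direction is that of the spaces: it is w that is bounded by v. *)
Definition wle (v w : R -> R) : Prop :=
  exists A : R, 1 <= A /\ forall t : R, 0 <= t -> w t <= A * v t.

Definition wequiv (v w : R -> R) : Prop := wle v w /\ wle w v.

Definition in_B (v : R -> R) (f : C -> C) : Prop :=
  entire f /\ forall z : C, Cmod (f z) <= / v (Cmod z).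

(* The supremum is finite when v is positive on [0,+oo). *)
Definition w_tilde (v : R -> R) (z : C) : R :=
  real (Lub_Rbar (fun y : R => exists f : C -> C, in_B v f /\ y = Cmod (f z))).

(* [in_B v] is stable under rotations of the variable, so [w_tilde v z] depends
   only on [Cmod z] and its value on the circle of radius t is read off at the
   point t of the real axis. *)
Definition v_tilde (v : R -> R) (t : R) : R := / w_tilde v (RtoC t).

Definition essential (v : R -> R) : Prop := weight v /\ wequiv v (v_tilde v).

(* [/ INR 0] is meaningless, but the term j = 0 does not affect the limit. *)
Definition weight_sequence (M : nat -> R) : Prop :=
  (forall j : nat, 0 < M j) /\
  M 0%nat = 1 /\
  is_lim_seq (fun j : nat => Rpower (M j) (/ INR j)) p_infty.

Definition log_convex (M : nat -> R) : Prop :=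
  forall j : nat, (1 <= j)%nat -> M j ^ 2 <= M (j - 1)%nat * M (j + 1)%nat.

(* For a weight sequence the supremum is finite at every t > 0. *)
Definition omega (M : nat -> R) (t : R) : R :=
  if Rlt_dec 0 t
  then real (Sup_seq (fun j : nat => Finite (ln (t ^ j / M j))))
  else 0.

Definition v_of (M : nat -> R) (t : R) : R := exp (- omega M t).

Definition Hinf_included (v w : R -> R) : Prop :=
  forall f : C -> C, Hinf v f -> Hinf w f.

(* Continuity of the identity, as a map between the metric spaces
   (Hinf v, norm_v v) and (Hinf w, norm_v w). *)
Definition inclusion_continuous (v w : R -> R) : Prop :=
  forall f : C -> C, Hinf v f ->
  forall eps : R, 0 < eps ->
  exists delta : R, 0 < delta /\
    forall g : C -> C, Hinf v g ->
      Rbar_lt (norm_v v (fun z => (g z - f z)%C)) delta ->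
      Rbar_lt (norm_v w (fun z => (g z - f z)%C)) eps.

Definition Hinf_equal (v w : R -> R) : Prop :=
  (forall f : C -> C, Hinf v f <-> Hinf w f) /\
  (exists A : R, 1 <= A /\ forall f : C -> C, Hinf v f ->
     Rbar_le (Rbar_mult (/ A) (norm_v v f)) (norm_v w f) /\
     Rbar_le (norm_v w f) (Rbar_mult A (norm_v v f))).

(* Main.v *)
Require Import Defs.
From Stdlib Require Import Reals Lra Lia.
From Coquelicot Require Import Coquelicot.
Open Scope R_scope.

(** Everything rests on one description of [v_of M]: for [t >= 0], the number
    [v_of M t] is the largest [b] such that [t ^ j * b <= M j] for all [j]
    ([v_of_pow_le] and [le_v_of]).  The first half says that the monomial
    [z ^ j] has norm at most [M j] in the space of [v_of M]; the second half
    says that a function [w] with [t ^ j * w t <= A * M j] for all [j] is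
    bounded by [A] times [v_of M] ([wle_of_monomials]).  Monomials therefore
    detect the weight, and this gives each claim.

    - Essential: the monomials [z ^ j / M j] lie in the unit ball of the space,
      and the supremum of their moduli at [t] is already [/ v_of M t].  So
      [v_tilde (v_of M)] is equal to [v_of M].
    - If the inclusion of the spaces is bounded on monomials, in particular if it
      is continuous at [0], then [wle_of_monomials] bounds one weight by the other.
      The converse is immediate from the definition of the norm.
    - An inequality [N j <= A * M j] gives [t ^ j * v_of N t <= A * M j], hence
      [wle (v_of M) (v_of N)].  The converse uses log-convexity: the
      quotients [N (j + 1) / N j] are nondecreasing, so at the point
      [t = N (j + 1) / N j] the numbers [N k / t ^ k] are smallest for [k = j].
      Thus [v_of N t = N j / t ^ j], and comparing with
      [v_of M t <= M j / t ^ j] gives [N j <= A * M j].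

    Since [M j] eventually exceeds [T ^ j] for every [T], on a bounded interval
    the supremum defining [omega M] is a maximum over finitely many indices.  The
    description of [v_of M] and its continuity follow from this; its decay comes
    from [t ^ k * v_of M t <= M (k + 1) / t]. *)

(** * The weight of a sequence *)

(** The maximum of the first [n + 1] functions whose supremum is [/ v_of M]. *)
Fixpoint partial_max (M : nat -> R) (n : nat) (t : R) : R :=
  match n with
  | O => t ^ 0 / M O
  | S m => Rmax (partial_max M m t) (t ^ S m / M (S m))
  end.

Lemma partial_max_ge (M : nat -> R) (n j : nat) (t : R) :
  (j <= n)%nat -> t ^ j / M j <= partial_max M n t.
Proof.
  induction n as [|n IH]; intros h.
  - replace j with 0%nat by lia; simpl; lra.
  - destruct (Nat.eq_dec j (S n)) as [->|ne].
    + apply Rmax_r.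
    + eapply Rle_trans; [apply IH; lia | apply Rmax_l].
Qed.

Lemma partial_max_attained (M : nat -> R) (n : nat) (t : R) :
  exists j : nat, partial_max M n t = t ^ j / M j.
Proof.
  induction n as [|n [j IH]].
  - now exists 0%nat.
  - change (partial_max M (S n) t)
      with (Rmax (partial_max M n t) (t ^ S n / M (S n))).
    unfold Rmax; destruct (Rle_dec _ _).
    + now exists (S n).
    + now exists j.
Qed.

Lemma continuous_partial_max (M : nat -> R) (n : nat) (t : R) :
  continuous (partial_max M n) t.
Proof.
  assert (hq : forall j x, continuous (fun s => s ^ j / M j) x).
  { intros j x; apply (ex_derive_continuous (V := R_NormedModule)).
    auto_derive; trivial. }
  induction n as [|n IH]; [apply (hq 0%nat)|].
  apply continuous_ext with
    (fun s => (partial_max M n s + s ^ S n / M (S n)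
               + Rabs (partial_max M n s - s ^ S n / M (S n))) * / 2).
  { intros s.
    change (partial_max M (S n) s)
      with (Rmax (partial_max M n s) (s ^ S n / M (S n))).
    unfold Rmax; destruct (Rle_dec _ _);
      [rewrite Rabs_left1 by lra | rewrite Rabs_right by lra]; lra. }
  apply (continuous_mult (K := R_AbsRing)); [|apply continuous_const].
  apply (continuous_plus (V := R_NormedModule)).
  - now apply (continuous_plus (V := R_NormedModule)); [|apply (hq (S n))].
  - apply (continuous_comp (fun s => partial_max M n s - s ^ S n / M (S n)) Rabs).
    + now apply (continuous_minus (V := R_NormedModule)); [|apply (hq (S n))].
    + apply continuous_Rabs.
Qed.

Lemma weight_sequence_pow_le (M : nat -> R) (T : R) :
  weight_sequence M -> 0 < T ->
  exists J : nat, forall j : nat, (J <= j)%nat -> T ^ j <= M j.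
Proof.
  intros (hpos & _ & hlim) hT.
  apply is_lim_seq_spec in hlim.
  destruct (hlim T) as [J hJ].
  exists (S J); intros j hj.
  specialize (hJ j ltac:(lia)).
  assert (hj0 : 0 < INR j) by (apply lt_0_INR; lia).
  rewrite <- Rpower_pow by assumption.
  replace (M j) with (Rpower (Rpower (M j) (/ INR j)) (INR j)).
  - apply Rle_Rpower_l; lra.
  - rewrite Rpower_mult, Rinv_l, Rpower_1; trivial; lra.
Qed.

(** Indices beyond some [J] contribute at most [1] on [[0, T]], which is the
    contribution of the index [0]. *)
Lemma locally_finite_max (M : nat -> R) (T : R) :
  weight_sequence M -> 0 < T ->
  exists J : nat, forall t : R, 0 <= t <= T ->
    forall j : nat, t ^ j / M j <= partial_max M J t.
Proof.
  intros hM hT.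
  destruct (weight_sequence_pow_le M T hM hT) as [J hJ].
  destruct hM as (hpos & h0 & _).
  exists J; intros t ht j.
  destruct (Compare_dec.le_lt_dec j J) as [h|h]; [now apply partial_max_ge|].
  apply Rle_trans with (t ^ 0 / M 0%nat); [|apply partial_max_ge; lia].
  rewrite h0; simpl.
  apply Rle_div_l; [apply hpos|].
  assert (t ^ j <= T ^ j) by now apply pow_incr.
  specialize (hJ j ltac:(lia)); lra.
Qed.

Lemma partial_max_pos (M : nat -> R) (n : nat) (t : R) :
  M 0%nat = 1 -> 0 < partial_max M n t.
Proof.
  intros h0.
  apply Rlt_le_trans with (t ^ 0 / M 0%nat); [rewrite h0; simpl; lra|].
  apply partial_max_ge; lia.
Qed.

Lemma v_of_partial_max (M : nat -> R) (n : nat) (t : R) :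
  weight_sequence M -> 0 <= t ->
  (forall j : nat, t ^ j / M j <= partial_max M n t) ->
  v_of M t = / partial_max M n t.
Proof.
  intros (hpos & h0 & _) ht hn.
  assert (hp := partial_max_pos M n t h0).
  destruct (partial_max_attained M n t) as [i hi].
  unfold v_of, omega; destruct (Rlt_dec 0 t) as [h|h].
  - rewrite (is_sup_seq_unique _ (Finite (ln (partial_max M n t)))).
    + simpl; now rewrite exp_Ropp, exp_ln.
    + intros eps; assert (he := cond_pos eps); split.
      * intros j; simpl.
        assert (ln (t ^ j / M j) <= ln (partial_max M n t)); [|lra].
        apply ln_le; [|apply hn].
        apply Rdiv_lt_0_compat; [now apply pow_lt | apply hpos].
      * exists i; rewrite <- hi; simpl; lra.
  - (* At [t = 0] only the index [0] contributes, by the convention [0 ^ 0 = 1]. *)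
    replace t with 0 in * by lra.
    rewrite Ropp_0, exp_0.
    assert (h1 := hn 0%nat); rewrite h0 in h1; simpl in h1.
    assert (partial_max M n 0 <= 1); [|replace (partial_max M n 0) with 1; lra].
    rewrite hi; destruct i; [rewrite h0; simpl; lra|].
    simpl; unfold Rdiv; rewrite !Rmult_0_l; lra.
Qed.

Lemma v_of_local (M : nat -> R) (T : R) :
  weight_sequence M -> 0 < T ->
  exists n : nat, forall t : R, 0 <= t <= T ->
    v_of M t = / partial_max M n t /\
    forall j : nat, t ^ j / M j <= partial_max M n t.
Proof.
  intros hM hT.
  destruct (locally_finite_max M T hM hT) as [n hn].
  exists n; intros t ht; split; [|now apply hn].
  apply v_of_partial_max; [assumption|lra|now apply hn].
Qed.

Lemma v_of_pos (M : nat -> R) (t : R) : 0 < v_of M t.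
Proof. apply exp_pos. Qed.

Lemma v_of_pow_le (M : nat -> R) (j : nat) (t : R) :
  weight_sequence M -> 0 <= t -> t ^ j * v_of M t <= M j.
Proof.
  intros hM ht.
  destruct (v_of_local M (t + 1) hM ltac:(lra)) as [n hn].
  destruct (hn t ltac:(lra)) as [-> hmax].
  assert (hpos : 0 < M j) by apply hM.
  assert (hp : 0 < partial_max M n t) by (apply partial_max_pos, hM).
  apply Rle_div_l; [assumption|].
  specialize (hmax j); apply Rle_div_l in hmax; lra.
Qed.

(** The supremum is attained, so its index already tests [b]. *)
Lemma le_v_of (M : nat -> R) (t b : R) :
  weight_sequence M -> 0 <= t ->
  (forall j : nat, t ^ j * b <= M j) -> b <= v_of M t.
Proof.
  intros hM ht hb.
  destruct (v_of_local M (t + 1) hM ltac:(lra)) as [n hn].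
  destruct (hn t ltac:(lra)) as [-> _].
  assert (hp : 0 < partial_max M n t) by (apply partial_max_pos, hM).
  destruct (partial_max_attained M n t) as [i hi].
  assert (hpos : 0 < M i) by apply hM.
  rewrite <- (Rmult_1_l (/ _)); apply Rle_div_r; [assumption|].
  rewrite hi; replace (b * (t ^ i / M i)) with (t ^ i * b / M i) by (field; lra).
  apply Rle_div_l; [assumption|]; rewrite Rmult_1_l; apply hb.
Qed.

Lemma continuous_on_v_of (M : nat -> R) :
  weight_sequence M -> continuous_on (fun t => 0 <= t) (v_of M).
Proof.
  intros hM x hx.
  destruct (v_of_local M (x + 1) hM ltac:(lra)) as [n hn].
  rewrite (proj1 (hn x ltac:(lra))).
  apply filterlim_ext_loc with (fun t => / partial_max M n t).
  - exists (mkposreal 1 Rlt_0_1); intros t ht h0; symmetry; apply hn.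
    change (Rabs (t - x) < 1) in ht; apply Rabs_def2 in ht; lra.
  - refine (filterlim_filter_le_1 _ (filter_le_within (F := locally x) _) _).
    apply (continuous_comp (partial_max M n) Rinv).
    + apply continuous_partial_max.
    + apply continuous_Rinv, Rgt_not_eq, partial_max_pos, hM.
Qed.

Lemma weight_v_of (M : nat -> R) : weight_sequence M -> weight (v_of M).
Proof.
  intros hM; split; [|split; [|split]].
  - now apply continuous_on_v_of.
  - intros s t hs hst; apply le_v_of; [assumption..|]; intros j.
    apply Rle_trans with (t ^ j * v_of M t); [|apply v_of_pow_le; [assumption|lra]].
    apply Rmult_le_compat_r; [apply Rlt_le, v_of_pos | now apply pow_incr].
  - intros t _; apply v_of_pos.
  - (* The index [k + 1] gives [t ^ k * v_of M t <= M (k + 1) / t]. *)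
    intros k.
    apply is_lim_le_le_loc with (fun _ => 0) (fun t => M (S k) / t).
    + exists 0; intros t ht; split.
      * apply Rmult_le_pos; [apply pow_le; lra | apply Rlt_le, v_of_pos].
      * apply (Rle_div_r _ _ t); [assumption|].
        assert (h := v_of_pow_le M (S k) t hM ltac:(lra)).
        simpl in h; lra.
    + apply is_lim_const.
    + replace (Finite 0) with (Rbar_mult (M (S k)) 0)
        by (simpl; now rewrite Rmult_0_r).
      apply is_lim_scal_l.
      apply is_lim_inv with (l := p_infty); [apply is_lim_id | discriminate].
Qed.

Lemma wle_of_bound (v w : R -> R) (A : R) :
  (forall t : R, 0 <= t -> 0 < v t) ->
  (forall t : R, 0 <= t -> w t <= A * v t) -> wle v w.
Proof.
  intros hv h; exists (Rmax 1 A); split; [apply Rmax_l|].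
  intros t ht; apply Rle_trans with (A * v t); [now apply h|].
  apply Rmult_le_compat_r; [apply Rlt_le; auto | apply Rmax_r].
Qed.

Lemma wle_of_monomials (M : nat -> R) (w : R -> R) (A : R) :
  weight_sequence M -> 0 < A ->
  (forall (j : nat) (t : R), 0 <= t -> t ^ j * w t <= A * M j) ->
  wle (v_of M) w.
Proof.
  intros hM hA h; apply wle_of_bound with A; [intros; apply v_of_pos|].
  intros t ht; rewrite Rmult_comm; apply Rle_div_l; [assumption|].
  apply le_v_of; [assumption..|]; intros j.
  replace (t ^ j * (w t / A)) with (t ^ j * w t / A) by (field; lra).
  apply Rle_div_l; [assumption|].
  specialize (h j t ht); lra.
Qed.

(** * Log-convex sequences are determined by their weight *)

Lemma log_convex_quotient_mono (N : nat -> R) (i j : nat) :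
  (forall k : nat, 0 < N k) -> log_convex N -> (i <= j)%nat ->
  N (S i) / N i <= N (S j) / N j.
Proof.
  intros hpos hc hij; induction hij as [|j hij IH]; [lra|].
  apply Rle_trans with (1 := IH).
  assert (h := hc (S j) ltac:(lia)).
  replace (S j - 1)%nat with j in h by lia.
  replace (S j + 1)%nat with (S (S j)) in h by lia.
  apply Rle_div_l; [apply hpos|].
  replace (N (S (S j)) / N (S j) * N j)
    with (N (S (S j)) * N j / N (S j)) by (field; apply Rgt_not_eq, hpos).
  apply Rle_div_r; [apply hpos|]; simpl in h; lra.
Qed.

(** With [t = N (j + 1) / N j], the sequence [t ^ k / N k] increases up to
    [k = j] and decreases from there on. *)
Lemma log_convex_touching_point (N : nat -> R) (j : nat) :
  (forall k : nat, 0 < N k) -> log_convex N ->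
  exists t : R, 0 < t /\ forall k : nat, t ^ k * N j <= t ^ j * N k.
Proof.
  intros hpos hc; exists (N (S j) / N j).
  set (t := N (S j) / N j).
  assert (ht : 0 < t) by (apply Rdiv_lt_0_compat; apply hpos).
  split; [assumption|].
  assert (up : forall i, t ^ i * N j <= N (j + i)%nat).
  { induction i as [|i IH]; [rewrite Nat.add_0_r; simpl; lra|].
    assert (h := log_convex_quotient_mono N j (j + i) hpos hc ltac:(lia)).
    fold t in h; apply Rle_div_r in h; [|apply hpos].
    rewrite Nat.add_succ_r; simpl.
    apply Rle_trans with (2 := h).
    rewrite Rmult_assoc; apply Rmult_le_compat_l; lra. }
  assert (down : forall i k, (k + i = j)%nat -> N j <= t ^ i * N k).
  { induction i as [|i IH]; intros k hk.
    - replace k with j by lia; simpl; lra.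
    - apply Rle_trans with (1 := IH (S k) ltac:(lia)).
      assert (h := log_convex_quotient_mono N k j hpos hc ltac:(lia)).
      fold t in h; apply (Rle_div_l _ _ _ (hpos k)) in h.
      simpl; rewrite (Rmult_comm t), Rmult_assoc.
      apply Rmult_le_compat_l; [apply pow_le|]; lra. }
  intros k; destruct (Compare_dec.le_lt_dec j k) as [h|h].
  - replace k with (j + (k - j))%nat by lia.
    rewrite pow_add, Rmult_assoc.
    apply Rmult_le_compat_l; [apply pow_le; lra | apply up].
  - replace j with (k + (j - k))%nat at 2 by lia.
    rewrite pow_add, Rmult_assoc.
    apply Rmult_le_compat_l; [apply pow_le; lra | apply down; lia].
Qed.

Lemma sequence_le_of_weight_le (M N : nat -> R) (A : R) :
  weight_sequence M -> weight_sequence N -> log_convex N -> 0 <= A ->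
  (forall t : R, 0 <= t -> v_of N t <= A * v_of M t) ->
  forall j : nat, N j <= A * M j.
Proof.
  intros hM hN hc hA h j.
  destruct (log_convex_touching_point N j (proj1 hN) hc) as (t & ht & hk).
  assert (htj : 0 < t ^ j) by now apply pow_lt.
  assert (h1 : N j / t ^ j <= v_of N t).
  { apply le_v_of; [assumption|lra|]; intros k.
    replace (t ^ k * (N j / t ^ j)) with (t ^ k * N j / t ^ j) by (field; lra).
    apply Rle_div_l; [assumption|]; rewrite (Rmult_comm (N k)); apply hk. }
  apply Rle_div_l in h1; [|assumption].
  apply Rle_trans with (1 := h1).
  apply Rle_trans with (A * (t ^ j * v_of M t)).
  - replace (A * (t ^ j * v_of M t)) with (A * v_of M t * t ^ j) by ring.
    apply Rmult_le_compat_r; [lra|apply h; lra].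
  - apply Rmult_le_compat_l; [assumption|apply v_of_pow_le; [assumption|lra]].
Qed.

Lemma sequence_le_iff_wle (M N : nat -> R) :
  weight_sequence M -> weight_sequence N -> log_convex N ->
  (exists A : R, 1 <= A /\ forall j : nat, N j <= A * M j)
    <-> wle (v_of M) (v_of N).
Proof.
  intros hM hN hc; split.
  - intros (A & hA & h); apply wle_of_monomials with A; [assumption|lra|].
    intros j t ht; apply Rle_trans with (N j); [now apply v_of_pow_le | apply h].
  - intros (A & hA & h); exists A; split; [assumption|].
    now apply sequence_le_of_weight_le; [..|lra|].
Qed.

(** * Weighted norms and monomials *)

Lemma norm_v_ub (v : R -> R) (f : C -> C) (z : C) :
  Rbar_le (Cmod (f z) * v (Cmod z)) (norm_v v f).
Proof. apply (proj1 (Lub_Rbar_correct _)); now exists z. Qed.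

Lemma norm_v_le (v : R -> R) (f : C -> C) (b : R) :
  (forall z : C, Cmod (f z) * v (Cmod z) <= b) -> Rbar_le (norm_v v f) b.
Proof.
  intros h; apply (proj2 (Lub_Rbar_correct _)).
  intros y (z & ->); apply h.
Qed.

Lemma norm_v_finite (v : R -> R) (f : C -> C) :
  Rbar_lt (norm_v v f) p_infty -> exists r : R, norm_v v f = Finite r.
Proof.
  intros h; assert (h0 := norm_v_ub v f 0).
  destruct (norm_v v f) as [r| |]; [now exists r|easy|easy].
Qed.

Lemma norm_v_le_mult (v w : R -> R) (A : R) (f : C -> C) :
  0 <= A -> (forall t : R, 0 <= t -> w t <= A * v t) ->
  Rbar_lt (norm_v v f) p_infty ->
  Rbar_le (norm_v w f) (Rbar_mult A (norm_v v f)).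
Proof.
  intros hA h hf; destruct (norm_v_finite v f hf) as [r hr].
  rewrite hr; apply (norm_v_le w f (A * r)); intros z.
  assert (hz := norm_v_ub v f z); rewrite hr in hz; simpl in hz.
  apply Rle_trans with (A * (Cmod (f z) * v (Cmod z))).
  - replace (A * (Cmod (f z) * v (Cmod z)))
      with (Cmod (f z) * (A * v (Cmod z))) by ring.
    apply Rmult_le_compat_l; [apply Cmod_ge_0 | apply h, Cmod_ge_0].
  - now apply Rmult_le_compat_l.
Qed.

Lemma Hinf_of_wle (v w : R -> R) (f : C -> C) :
  wle v w -> Hinf v f -> Hinf w f.
Proof.
  intros (A & hA & h) (he & hf); split; [assumption|].
  eapply Rbar_le_lt_trans; [apply (norm_v_le_mult v w A f); trivial; lra|].
  destruct (norm_v_finite v f hf) as [r ->]; exact I.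
Qed.

Definition monomial (c : R) (j : nat) (z : C) : C := (c * z ^ j)%C.

(** The rule for products produces derivatives of functions into [C] seen as a
    normed module over itself by way of its absolute value, whereas [entire]
    uses the normed module carried by [R * R].  The two have the same linear
    structure and the same norm. *)
Lemma is_derive_C_NormedModule (f : C -> C) (z d : C) :
  is_derive (K := C_AbsRing) (V := AbsRing_NormedModule C_AbsRing) f z d ->
  is_derive (K := C_AbsRing) (V := C_NormedModule) f z d.
Proof.
  intros [[hp hs hn] hd]; split; [|exact hd].
  split; [exact hp|exact hs|exact hn].
Qed.

Lemma entire_monomial (c : R) (j : nat) : entire (monomial c j).
Proof.
  intros z.
  assert (hp : exists d, is_derive (K := C_AbsRing)
                 (V := AbsRing_NormedModule C_AbsRing) (fun x : C => (x ^ j)%C) z d).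
  { induction j as [|j [d hd]].
    - exists zero; exact (is_derive_const (K := C_AbsRing)
        (V := AbsRing_NormedModule C_AbsRing) (RtoC 1) z).
    - eexists; exact (is_derive_mult (K := C_AbsRing) _ _ z _ _
        (is_derive_id (K := C_AbsRing) z) hd Cmult_comm). }
  destruct hp as [d hd]; eexists; apply is_derive_C_NormedModule.
  exact (is_derive_mult (K := C_AbsRing) _ _ z _ _
    (is_derive_const (K := C_AbsRing)
      (V := AbsRing_NormedModule C_AbsRing) (RtoC c) z) hd Cmult_comm).
Qed.

Lemma Cmod_monomial (c : R) (j : nat) (z : C) :
  0 <= c -> Cmod (monomial c j z) = c * Cmod z ^ j.
Proof.
  intros hc; unfold monomial.
  now rewrite Cmod_mult, Cmod_pow, Cmod_R, Rabs_right by lra.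
Qed.

Lemma norm_v_monomial_le (M : nat -> R) (c : R) (j : nat) :
  weight_sequence M -> 0 <= c ->
  Rbar_le (norm_v (v_of M) (monomial c j)) (c * M j).
Proof.
  intros hM hc; apply norm_v_le; intros z.
  rewrite Cmod_monomial, Rmult_assoc by assumption.
  apply Rmult_le_compat_l; [assumption|].
  apply v_of_pow_le; [assumption|apply Cmod_ge_0].
Qed.

Lemma Hinf_monomial (M : nat -> R) (c : R) (j : nat) :
  weight_sequence M -> 0 <= c -> Hinf (v_of M) (monomial c j).
Proof.
  intros hM hc; split; [apply entire_monomial|].
  eapply Rbar_le_lt_trans; [now apply norm_v_monomial_le | exact I].
Qed.

Lemma le_of_norm_v_monomial (w : R -> R) (c b : R) (j : nat) (t : R) :
  0 <= c -> 0 <= t -> Rbar_le (norm_v w (monomial c j)) b ->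
  c * t ^ j * w t <= b.
Proof.
  intros hc ht h.
  assert (h1 := Rbar_le_trans _ _ _ (norm_v_ub w (monomial c j) (RtoC t)) h).
  rewrite Cmod_monomial, Cmod_R, (Rabs_right t) in h1 by lra; exact h1.
Qed.

(** * Weights of sequences are essential *)

(** The monomials [z ^ j / M j] are in [in_B (v_of M)], and no function of
    [in_B (v_of M)] exceeds the supremum of their moduli. *)
Lemma v_tilde_v_of (M : nat -> R) (t : R) :
  weight_sequence M -> 0 <= t -> v_tilde (v_of M) t = v_of M t.
Proof.
  intros hM ht; unfold v_tilde, w_tilde.
  assert (hv := v_of_pos M t).
  assert (hct : Cmod (RtoC t) = t) by (rewrite Cmod_R; apply Rabs_right; lra).
  rewrite (is_lub_Rbar_unique _ (Finite (/ v_of M t))).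
  { simpl; apply Rinv_inv. }
  assert (hB : forall j, in_B (v_of M) (monomial (/ M j) j)).
  { intros j; assert (hj : 0 < M j) by apply hM.
    assert (hi : 0 < / M j) by now apply Rinv_0_lt_compat.
    split; [apply entire_monomial|]; intros z.
    rewrite Cmod_monomial by lra.
    rewrite <- (Rmult_1_l (/ v_of _ _)); apply (Rle_div_r _ _ _ (v_of_pos M _)).
    assert (h := v_of_pow_le M j (Cmod z) hM (Cmod_ge_0 z)).
    replace (/ M j * Cmod z ^ j * v_of M (Cmod z))
      with (Cmod z ^ j * v_of M (Cmod z) / M j) by (field; lra).
    apply Rle_div_l; [assumption|lra]. }
  split.
  - intros y (f & (_ & hf) & ->); specialize (hf (RtoC t)).
    rewrite hct in hf; exact hf.
  - intros [b| |] hb; [|exact I|].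
    + assert (hbj : forall j, / M j * t ^ j <= b).
      { intros j; assert (hj : 0 < / M j) by (apply Rinv_0_lt_compat, hM).
        assert (h := hb _ (ex_intro _ _ (conj (hB j) eq_refl))).
        rewrite Cmod_monomial, hct in h by lra; exact h. }
      assert (hb1 : 1 <= b).
      { assert (h := hbj 0%nat); rewrite (proj1 (proj2 hM)) in h; simpl in h; lra. }
      simpl; rewrite <- (Rinv_inv b).
      apply Rinv_le_contravar; [apply Rinv_0_lt_compat; lra|].
      apply le_v_of; [assumption..|]; intros j.
      apply Rle_div_l; [lra|].
      assert (hj : 0 < M j) by apply hM.
      specialize (hbj j); rewrite Rmult_comm in hbj.
      apply Rle_div_l in hbj; [lra|assumption].
    + exact (hb _ (ex_intro _ _ (conj (hB 0%nat) eq_refl))).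
Qed.

Lemma essential_v_of (M : nat -> R) : weight_sequence M -> essential (v_of M).
Proof.
  intros hM; split; [now apply weight_v_of|].
  split; exists 1; (split; [lra|]); intros t ht;
    rewrite v_tilde_v_of by assumption; lra.
Qed.

(** * Inclusions of the spaces *)

Lemma inclusion_continuous_of_wle (v w : R -> R) :
  wle v w -> inclusion_continuous v w.
Proof.
  intros (A & hA & h) f _ eps heps.
  assert (hd : 0 < eps / A) by (apply Rdiv_lt_0_compat; lra).
  exists (eps / A); split; [assumption|]; intros g _ hg.
  assert (hfin : Rbar_lt (norm_v v (fun z => (g z - f z)%C)) p_infty).
  { eapply Rbar_lt_le_trans; [exact hg|exact I]. }
  eapply Rbar_le_lt_trans; [apply (norm_v_le_mult v w A); trivial; lra|].
  destruct (norm_v_finite _ _ hfin) as [r hr]; rewrite hr in hg |- *.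
  simpl in hg |- *; apply Rlt_div_r in hg; lra.
Qed.

(** Continuity at [0] is tested on the multiples of [z ^ j] of norm at most half
    of the radius that it gives. *)
Lemma wle_of_inclusion_continuous (M : nat -> R) (w : R -> R) :
  weight_sequence M -> inclusion_continuous (v_of M) w -> wle (v_of M) w.
Proof.
  intros hM hc.
  destruct (hc (monomial 0 0) (Hinf_monomial M 0 0 hM ltac:(lra)) 1 Rlt_0_1)
    as (d & hd & h).
  assert (hd2 : 0 < 2 / d) by (apply Rdiv_lt_0_compat; lra).
  apply wle_of_monomials with (2 / d); [assumption..|].
  intros j t ht.
  assert (hj : 0 < M j) by apply hM.
  set (c := d / 2 / M j).
  assert (hcpos : 0 < c) by (apply Rdiv_lt_0_compat; lra).
  assert (hext : forall u : R -> R,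
    norm_v u (fun z => (monomial c j z - monomial 0 0 z)%C)
    = norm_v u (monomial c j)).
  { intros u; apply Lub_Rbar_eqset; intros y.
    assert (e : forall z, (monomial c j z - monomial 0 0 z)%C = monomial c j z)
      by (intros z; unfold monomial; ring).
    split; intros (z & ->); exists z; now rewrite e. }
  specialize (h (monomial c j) (Hinf_monomial M c j hM ltac:(lra))).
  rewrite !hext in h.
  assert (hN : Rbar_lt (norm_v w (monomial c j)) 1).
  { apply h; eapply Rbar_le_lt_trans; [apply norm_v_monomial_le; trivial; lra|].
    replace (c * M j) with (d / 2) by (unfold c; field; lra); simpl; lra. }
  apply Rbar_lt_le, (le_of_norm_v_monomial w c 1 j t) in hN; [|lra|assumption].
  replace (t ^ j * w t) with (2 / d * M j * (c * t ^ j * w t))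
    by (unfold c; field; lra).
  rewrite <- (Rmult_1_r (2 / d * M j)) at 2.
  apply Rmult_le_compat_l; [apply Rmult_le_pos; lra | assumption].
Qed.

(** A norm inequality between the spaces, tested on the powers of [z]. *)
Lemma wle_of_norm_le (M : nat -> R) (w : R -> R) (A : R) :
  weight_sequence M -> 0 < A ->
  (forall f : C -> C, Hinf (v_of M) f ->
     Rbar_le (norm_v w f) (Rbar_mult A (norm_v (v_of M) f))) ->
  wle (v_of M) w.
Proof.
  intros hM hA h; apply wle_of_monomials with A; [assumption..|].
  intros j t ht; rewrite <- (Rmult_1_l (t ^ j)).
  apply le_of_norm_v_monomial; [lra|assumption|].
  assert (hf := Hinf_monomial M 1 j hM Rle_0_1).
  eapply Rbar_le_trans; [now apply h|].
  destruct (norm_v_finite _ _ (proj2 hf)) as [r hr].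
  assert (hr' := norm_v_monomial_le M 1 j hM Rle_0_1).
  rewrite hr in hr' |- *; simpl in hr' |- *.
  apply Rmult_le_compat_l; lra.
Qed.

(** Stated for an arbitrary domain, to merge the constants of the two bounds for
    weights on [[0, +oo)] as well as for sequences. *)
Lemma two_sided_bound {T : Type} (D : T -> Prop) (f g : T -> R) :
  (forall x : T, D x -> 0 < f x) -> (forall x : T, D x -> 0 < g x) ->
  (exists A : R, 1 <= A /\ forall x : T, D x -> g x <= A * f x) /\
  (exists A : R, 1 <= A /\ forall x : T, D x -> f x <= A * g x) ->
  exists A : R, 1 <= A /\
    forall x : T, D x -> g x <= A * f x /\ f x <= A * g x.
Proof.
  intros hf hg ((A & hA & h) & (A' & hA' & h')).
  exists (Rmax A A'); split; [apply Rle_trans with (1 := hA), Rmax_l|].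
  intros x hx; split.
  - apply Rle_trans with (1 := h x hx).
    apply Rmult_le_compat_r; [now apply Rlt_le, hf | apply Rmax_l].
  - apply Rle_trans with (1 := h' x hx).
    apply Rmult_le_compat_r; [now apply Rlt_le, hg | apply Rmax_r].
Qed.

Lemma Hinf_equal_of_wequiv (v w : R -> R) :
  (forall t : R, 0 <= t -> 0 < v t) -> (forall t : R, 0 <= t -> 0 < w t) ->
  wequiv v w -> Hinf_equal v w.
Proof.
  intros hv hw (hvw & hwv); split.
  { intros f; split; now apply Hinf_of_wle. }
  destruct (two_sided_bound (fun t => 0 <= t) v w hv hw
              (conj hvw hwv)) as (A & hA & h).
  exists A; split; [assumption|]; intros f hf.
  assert (hf' := Hinf_of_wle v w f hvw hf).
  assert (b := norm_v_le_mult v w A f ltac:(lra)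
                 (fun t ht => proj1 (h t ht)) (proj2 hf)).
  assert (b' := norm_v_le_mult w v A f ltac:(lra)
                  (fun t ht => proj2 (h t ht)) (proj2 hf')).
  split; [|assumption].
  destruct (norm_v_finite _ _ (proj2 hf)) as [r er].
  destruct (norm_v_finite _ _ (proj2 hf')) as [s es].
  rewrite er, es in *; simpl in b' |- *.
  rewrite Rmult_comm; apply Rle_div_l; lra.
Qed.

Lemma wequiv_of_Hinf_equal (M N : nat -> R) :
  weight_sequence M -> weight_sequence N ->
  Hinf_equal (v_of M) (v_of N) -> wequiv (v_of M) (v_of N).
Proof.
  intros hM hN (heq & A & hA & h); split.
  - apply wle_of_norm_le with A; [assumption|lra|]; intros f hf; now apply h.
  - apply wle_of_norm_le with A; [assumption|lra|]; intros f hf.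
    assert (hf' := proj2 (heq f) hf).
    destruct (h f hf') as [b _].
    destruct (norm_v_finite _ _ (proj2 hf)) as [s es].
    destruct (norm_v_finite _ _ (proj2 hf')) as [r er].
    rewrite er, es in *; simpl in b |- *.
    rewrite Rmult_comm in b; apply Rle_div_l in b; lra.
Qed.

Theorem theorem3p5 (M N : nat -> R)
  (hM : weight_sequence M) (hN : weight_sequence N)
  (hMc : log_convex M) (hNc : log_convex N) :
  (essential (v_of M) /\ essential (v_of N)) /\
  ((exists A : R, 1 <= A /\ forall j : nat, N j <= A * M j)
     <-> wle (v_of M) (v_of N)) /\
  (wle (v_of M) (v_of N)
     <-> Hinf_included (v_of M) (v_of N) /\
         inclusion_continuous (v_of M) (v_of N)) /\
  ((exists A : R, 1 <= A /\
      forall j : nat, / A * N j <= M j /\ M j <= A * N j)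
     <-> wequiv (v_of M) (v_of N)) /\
  (wequiv (v_of M) (v_of N) <-> Hinf_equal (v_of M) (v_of N)).
Proof.
  split; [split; now apply essential_v_of|].
  split; [now apply sequence_le_iff_wle|].
  split; [|split].
  - split.
    + intros h; split; [intros f; now apply Hinf_of_wle|].
      now apply inclusion_continuous_of_wle.
    + intros [_ h]; now apply wle_of_inclusion_continuous.
  - assert (hiff : forall A j, 1 <= A -> (/ A * N j <= M j <-> N j <= A * M j)).
    { intros A j hA; rewrite (Rmult_comm (/ A)), (Rmult_comm A).
      apply Rle_div_l; lra. }
    assert (hs := two_sided_bound (fun _ : nat => True) M N
                    (fun j _ => proj1 hM j) (fun j _ => proj1 hN j)).
    unfold wequiv; rewrite <- !sequence_le_iff_wle by assumption.
    split.
    + intros (A & hA & h); split; exists A; (split; [assumption|]); intros j.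
      * apply hiff; [assumption|apply h].
      * apply h.
    + intros ((A & hA & h) & (A' & hA' & h')).
      destruct hs as (B & hB & hb).
      { split; [exists A | exists A']; auto. }
      exists B; split; [assumption|]; intros j; split.
      * now apply hiff, hb.
      * now apply hb.
  - split.
    + apply Hinf_equal_of_wequiv; intros; apply v_of_pos.
    + now apply wequiv_of_Hinf_equal.
Qed.
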